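(* Let $G=(V,E)$ be a weakly observable directed graph containing at most $C$ vertices that are not strongly observable. Then there is $T_0$ such that for every $T\ge T_0$ there is an algorithm for bandit with feedback graph $G$ and horizon $T$ such that for every loss sequence $\ell^{(1)},\dots,\ell^{(T)}$ its regret satisfies $$R(T)\le 9\cdot(4C)^{\frac13}\cdot T^{\frac23}.$$
   Context: **Problem (bandit with graph feedback).** $G=(V,E)$ is a finite directed graph, possibly with self-loops; vertices are called arms. $N_{\mathrm{in}}(v)=\{u:(u,v)\in E\}$, $N_{\mathrm{out}}(v)=\{u:(v,u)\in E\}$. The player knows $G$ and the horizon $T$. In each round $t=1,\dots,T$ the player's (randomized) algorithm computes from past observations a distribution on $V$ and samples an arm $A_t$ from it; there is a loss vector $\ell^{(t)}:V\to[0,1]$; the player pays $\ell^{(t)}(A_t)$ and observes exactly the values $\ell^{(t)}(v)$ for $v\in N_{\mathrm{out}}(A_t)$. For a fixed loss sequence, the regret with respect to arm $a$ is $R_a(T)=\mathbf E[\sum_{t=1}^T\ell^{(t)}(A_t)]-\sum_{t=1}^T\ell^{(t)}(a)$, and $R(T)=R_{a^*}(T)$ with $a^*\in\arg\min_a\sum_t\ell^{(t)}(a)$, i.e. $R(T)=\max_aR_a(T)$. **Observability.** A vertex $v$ is non-observable if $N_{\mathrm{in}}(v)=\emptyset$; it is strongly observable if it has a self-loop or $N_{\mathrm{in}}(v)=V\setminus\{v\}$. A graph is non-observable if it has a non-observable vertex, strongly observable if all its vertices are strongly observable, and weakly observable if it is neither non-observable nor strongly observable. *)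

(* Defs.v *)
From HB Require Import structures.
From mathcomp Require Import all_boot all_order all_algebra.
From mathcomp Require Import all_classical all_reals all_analysis.

Set Implicit Arguments.
Unset Strict Implicit.
Unset Printing Implicit Defensive.
Import Order.TTheory GRing.Theory Num.Theory.
Local Open Scope ring_scope.

(* A directed graph, possibly with self-loops, is an arbitrary relation
   E on its vertex type V; E u v means that (u, v) is an edge. *)

Section Observability.
Variables (V : finType) (E : rel V).

Definition Nin (v : V) : {set V} := [set u | E u v]%SET.
Definition Nout (v : V) : {set V} := [set u | E v u]%SET.

Definition non_observable_vertex (v : V) : bool := Nin v == finset.set0.

Definition strongly_observable_vertex (v : V) : bool :=
  E v v || (Nin v == ([set: V] :\ v)%SET).

Definition non_observable : bool :=
  [exists v, non_observable_vertex v].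

Definition strongly_observable : bool :=
  [forall v, strongly_observable_vertex v].

Definition weakly_observable : bool :=
  ~~ non_observable && ~~ strongly_observable.

End Observability.

Section Bandit.
Variables (R : realType) (V : finType).

(* What the player sees in one round: the arm played, and the table of losses
   in which the unobserved entries are None. *)
Definition observation : Type := (V * {ffun V -> option R})%type.

(* The conditional law of the next arm given the past observations, listed in
   chronological order. *)
Record algorithm := Algorithm {
  policy :> seq observation -> V -> R;
  policy_ge0 : forall h v, 0 <= policy h v;
  policy_sum1 : forall h, \sum_v policy h v = 1
}.

Variables (E : rel V) (T : nat).

Definition observe (l : V -> R) (a : V) : observation :=
  (a, [ffun v => if v \in Nout E a then Some (l v) else None]).

(* The observations made strictly before round t when x lists the arms
   played. *)
Definition history (loss : 'I_T -> V -> R) (x : T.-tuple V) (t : 'I_T) :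
    seq observation :=
  [seq observe (loss s) (tnth x s) | s : 'I_T <- enum 'I_T & (s < t)%N].

(* The probability that (A_1, ..., A_T) = x. *)
Definition trajectory_prob (alg : algorithm) (loss : 'I_T -> V -> R)
    (x : T.-tuple V) : R :=
  \prod_(t < T) alg (history loss x t) (tnth x t).

Definition expected_loss (alg : algorithm) (loss : 'I_T -> V -> R) : R :=
  \sum_(x : T.-tuple V)
    trajectory_prob alg loss x * \sum_(t < T) loss t (tnth x t).

Definition arm_loss (loss : 'I_T -> V -> R) (a : V) : R :=
  \sum_(t < T) loss t a.

Definition regret_wrt (alg : algorithm) (loss : 'I_T -> V -> R) (a : V) : R :=
  expected_loss alg loss - arm_loss loss a.

(* Since V is finite, this supremum is a maximum as soon as V is inhabited;
   see regretE. *)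
Definition regret (alg : algorithm) (loss : 'I_T -> V -> R) : R :=
  sup [set regret_wrt alg loss a | a in [set: V]]%classic.

Lemma regretE (alg : algorithm) (loss : 'I_T -> V -> R) (a : V) :
  (forall b, arm_loss loss a <= arm_loss loss b) ->
  regret alg loss = regret_wrt alg loss a.
Proof.
move=> amin; apply/eqP; rewrite eq_le; apply/andP; split.
  apply: ge_sup; first by exists (regret_wrt alg loss a), a.
  by move=> _ [b _ <-]; rewrite lerD2l lerN2.
apply: ub_le_sup; last by exists a.
by exists (regret_wrt alg loss a) => _ [b _ <-]; rewrite lerD2l lerN2.
Qed.

End Bandit.

(* Main.v *)
Require Import Defs.
From HB Require Import structures.
From mathcomp Require Import all_boot all_order all_algebra.
From mathcomp Require Import all_classical all_reals all_analysis.
From mathcomp Require Import ring lra.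

Set Implicit Arguments.
Unset Strict Implicit.
Unset Printing Implicit Defensive.
Import Order.TTheory GRing.Theory Num.Theory.
Import numFieldNormedType.Exports.
Local Open Scope ring_scope.

(** Fix an in-neighbour f v of every vertex v. In each round an arm v is sampled
    from a distribution x, and then v is played with probability 1 - gamma and
    f v with probability gamma, so that v is observed with probability at least
    gamma * x v. The distribution x follows online mirror descent on importance
    weighted loss estimates, with the Tsallis-1/2 potential
    - 2 * \sum_i (eta i)^-1 * Num.sqrt (x i); the rate eta i is e at the k <= C
    weak vertices and a larger e' at the strongly observable ones.
    The weak vertices contribute Num.sqrt k / e to the initial divergence and
    e * Num.sqrt k / gamma to the variance of a round. With
    Q = C `^ (1 / 3) * T `^ (2 / 3), gamma = Q / T and e = Num.sqrt C / Q, these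
    terms and the exploration cost gamma * T all have order Q. The variance of
    the strongly observable vertices does not involve 1 / gamma, so the rate
    e' = 3 |V| C / Q makes their divergence at most of order Q, while their total
    variance, of order T / Q, becomes smaller than Q when T is large. *)

(** * Unit vectors with positive coordinates *)

(* The distribution of the sampled arm is represented by its square roots: arm i
   has probability r i ^+ 2. *)
Record sphere_point (R : realType) (V : finType) := SpherePoint {
  coord :> V -> R;
  coord_gt0 : forall i, 0 < coord i;
  coord_sum : \sum_i coord i ^+ 2 = 1 }.

Lemma sphere_card_gt0 (R : realType) (V : finType) (r : sphere_point R V) :
  (0 < #|V|)%N.
Proof.
rewrite lt0n; apply/eqP => V0; have := coord_sum r.
rewrite big_pred0 => [/esym/eqP|i]; first by rewrite oner_eq0.
by have := fintype0 i V0.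
Qed.

Lemma sphere_sq_le1 (R : realType) (V : finType) (r : sphere_point R V) (i : V) :
  r i ^+ 2 <= 1.
Proof.
rewrite -(coord_sum r) (bigD1 i)//= lerDl sumr_ge0// => j _; exact: sqr_ge0.
Qed.

Lemma sphere_le1 (R : realType) (V : finType) (r : sphere_point R V) (i : V) :
  r i <= 1.
Proof.
by have := sphere_sq_le1 r i; rewrite expr_le1// ltW// coord_gt0.
Qed.

Lemma sphere_sq_le (R : realType) (V : finType) (r : sphere_point R V)
    (i j : V) :
  i != j -> r i ^+ 2 <= 1 - r j ^+ 2.
Proof.
move=> ij; rewrite -(coord_sum r) (bigD1 j)//= addrAC subrr add0r.
by rewrite (bigD1 i)//= lerDl sumr_ge0// => k _; exact: sqr_ge0.
Qed.

(** Cauchy-Schwarz, done termwise through [r i <= s / 2 * r i ^+ 2 + (2 * s)^-1], so that [s ^+ 2]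
    may be any upper bound on the cardinality. *)
Lemma sphere_sum_le (R : realType) (V : finType) (r : sphere_point R V)
    (A : pred V) (s : R) :
  0 < s -> #|A|%:R <= s ^+ 2 -> \sum_(i | A i) r i <= s.
Proof.
move=> s0 As.
apply: (@le_trans _ _ (\sum_(i | A i) (s / 2 * r i ^+ 2 + (2 * s)^-1))).
  apply: ler_sum => i _; rewrite -subr_ge0.
  have -> : s / 2 * r i ^+ 2 + (2 * s)^-1 - r i = (s * r i - 1) ^+ 2 / (2 * s).
    by field; rewrite gt_eqF.
  by rewrite divr_ge0 ?sqr_ge0// mulr_ge0// ltW.
rewrite big_split/= -mulr_sumr sumr_const -mulr_natr.
have : \sum_(i | A i) r i ^+ 2 <= 1.
  rewrite -(coord_sum r) [leRHS](bigID A)/= lerDl sumr_ge0// => i _.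
  exact: sqr_ge0.
move=> /(ler_wpM2l (ltW s0)).
have : (2 * s)^-1 * #|A|%:R <= s / 2.
  by rewrite mulrC ler_pdivrMr ?mulr_gt0//; nra.
by lra.
Qed.

(** * Mirror descent with one rate per vertex *)

Section MirrorDescent.
Variables (R : realType) (V : finType) (eta : V -> R).
Hypothesis eta_gt0 : forall i, 0 < eta i.

(* For the potential - 2 * \sum_i (eta i)^-1 * Num.sqrt (x i), this is the optimality
   condition of the mirror step; lam normalizes the new distribution. *)
Lemma mirror_step_ex (r : sphere_point R V) (l : V -> R) :
  exists r' : sphere_point R V, exists lam : R,
    forall i, (r' i)^-1 = (r i)^-1 + eta i * (l i - lam).
Proof.
have n0 := sphere_card_gt0 r.
have [i0 _] : exists i : V, i \in V by apply/card_gt0P.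
(* The optimality condition forces the new square roots to be [(eta i * (z i - lam))^-1]. Their
   squares are [phi i lam], and [lam] comes from the intermediate value theorem. *)
pose z i := (eta i * r i)^-1 + l i.
pose phi i (x : R) := ((eta i * (z i - x)) ^-1) ^+ 2.
have [j _ zj] := @arg_minP _ _ _ i0 predT z isT.
pose k := [arg min_(i < i0) eta i]%O.
have kmin i : eta k <= eta i.
  by rewrite /k; case: arg_minP => // k' _ /(_ i isT).
pose n : R := #|V|%:R.
have n1 : 1 <= n by rewrite ler1n.
(* At [hi] the term of [j] alone is 1; at [lo] every term is at most [n ^- 2], as [eta k] is the
   smallest rate. Up to [hi] no denominator vanishes, as [z j] is the smallest. *)
pose lo := z j - n / eta k; pose hi := z j - (eta j)^-1.
have lohi : lo <= hi.
  rewrite lerD2l lerN2 -[X in X <= _]mul1r ler_pM ?invr_ge0 ?(ltW (eta_gt0 _))//.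
  by rewrite lef_pV2 ?posrE.
have pos i x : x <= hi -> 0 < z i - x.
  move=> xhi; have := zj i isT; have : 0 < (eta j)^-1 by rewrite invr_gt0.
  by rewrite /hi in xhi; lra.
have [lam lamI] : exists2 c, c \in `[lo, hi] & (\sum_i phi i c) = 1.
  apply: IVT => //.
    apply: (@continuous_in_subspaceT) => x; rewrite inE/= in_itv/= => /andP[_ xhi].
    apply: (cvg_big add_continuous) => i _.
    have w_cvg : ((eta i * (z i - y))^-1 @[y --> x]
        --> (eta i * (z i - x))^-1)%classic.
      apply: cvgV; first by rewrite gt_eqF// mulr_gt0 ?pos.
      by apply: cvgM; [exact: cvg_cst|apply: cvgB; [exact: cvg_cst|exact: cvg_id]].
    exact: (cvgM w_cvg w_cvg).
  have philo : \sum_i phi i lo <= 1.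
    apply: (@le_trans _ _ (\sum_(i : V) n^-1)); last first.
      by rewrite sumr_const -mulr_natl divff// pnatr_eq0 -lt0n.
    apply: ler_sum => i _; rewrite /phi exprVn lef_pV2 ?posrE; last 2 first.
    - by rewrite exprn_gt0// mulr_gt0// pos.
    - by lra.
    have h : n <= eta i * (z i - lo).
      have : n / eta k <= z i - lo by rewrite /lo; have := zj i isT; lra.
      move=> /(ler_wpM2l (ltW (eta_gt0 i))); apply: le_trans.
      rewrite mulrCA -[X in X <= _]mulr1 ler_wpM2l ?ler_pdivlMr ?mul1r//.
    by nra.
  have phihi : 1 <= \sum_i phi i hi.
    rewrite (bigD1 j)//= /phi {1}/hi subKr mulfV ?gt_eqF//.
    by rewrite invr1 expr1n lerDl sumr_ge0// => i _; rewrite sqr_ge0.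
  by rewrite ge_min le_max philo phihi orbT.
move: lamI; rewrite in_itv/= => /andP[_ lamhi] lam1.
have rpos i : 0 < (eta i * (z i - lam))^-1 by rewrite invr_gt0 mulr_gt0// pos.
exists (SpherePoint rpos lam1), lam => i /=.
rewrite invrK /z mulrBr mulrDr invfM mulrA mulfV ?gt_eqF// mul1r.
by rewrite mulrBr addrA.
Qed.

Definition mirror_step (r : sphere_point R V) (l : V -> R) : sphere_point R V :=
  projT1 (cid (mirror_step_ex r l)).

Lemma mirror_stepE (r : sphere_point R V) (l : V -> R) :
  exists lam : R,
    forall i, (mirror_step r l i)^-1 = (r i)^-1 + eta i * (l i - lam).
Proof. exact: (projT2 (cid (mirror_step_ex r l))). Qed.

(* The Bregman divergence to the indicator of arm a, in the case of the potential
   - 2 * \sum_i (eta i)^-1 * Num.sqrt (x i). *)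
Definition divergence (a : V) (r : V -> R) : R :=
  \sum_i (eta i)^-1 * (((i == a)%:R - r i) ^+ 2 / r i).

(* The left-hand side is concave in s when l >= c; when l < c the condition on
   e * r * c keeps half of the quadratic term. *)
Lemma coordinate_bound (e r s l c : R) : 0 < e -> 0 < r -> 0 < s ->
  0 <= l -> 0 <= c -> e * r * c <= 1 / 2 ->
  (l - c) * (r ^+ 2 - s ^+ 2) - e^-1 * ((s - r) ^+ 2 / r)
    <= e * r ^+ 3 * (l ^+ 2 + 2 * c ^+ 2).
Proof.
move=> e0 r0 s0 l0 c0 erc.
have er0 : 0 < e * r by rewrite mulr_gt0.
rewrite -subr_ge0; set d := s - r.
have -> : s = r + d by rewrite /d; lra.
have -> : e * r ^+ 3 * (l ^+ 2 + 2 * c ^+ 2)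
   - ((l - c) * (r ^+ 2 - (r + d) ^+ 2) - e^-1 * (d ^+ 2 / r))
   = ((e * r * r) ^+ 2 * (l ^+ 2 + 2 * c ^+ 2) + d ^+ 2
       + (e * r * r) * 2 * d * (l - c) + (e * r) * d ^+ 2 * (l - c)) / (e * r).
  by field; rewrite !gt_eqF.
rewrite divr_ge0 ?(ltW er0)//.
set p := e * r in er0 erc *; have p0 := ltW er0.
have pr2 : 0 <= (p * r) ^+ 2 := sqr_ge0 _; have d2 : 0 <= d ^+ 2 := sqr_ge0 _.
have [lc|/ltW cl] := leP c l.
  have lc0 : 0 <= l - c by rewrite subr_ge0.
  have := mulr_ge0 (mulr_ge0 p0 d2) lc0.
  have := sqr_ge0 (p * r * (l - c) + d).
  have := mulr_ge0 pr2 (mulr_ge0 c0 lc0).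
  have := mulr_ge0 pr2 (sqr_ge0 c).
  by nra.
(* Half of [d ^+ 2] absorbs the negative cubic term. Completing the square with the other half costs
   [2 * (l - c) ^+ 2 <= l ^+ 2 + 2 * c ^+ 2], hence the factor 2 in the bound. *)
have lc0 : 0 <= c - l by rewrite subr_ge0.
have : 0 <= d ^+ 2 * (1 / 2 - p * c) by rewrite mulr_ge0 ?subr_ge0.
have := mulr_ge0 (mulr_ge0 p0 d2) l0.
have := sqr_ge0 (2 * (p * r * (l - c)) + d).
have := mulr_ge0 pr2 (mulr_ge0 l0 lc0).
have := mulr_ge0 pr2 (mulr_ge0 l0 c0).
have := mulr_ge0 pr2 (sqr_ge0 l).
by nra.
Qed.

(** The old and the new distribution have equal mass, so subtracting [c] from all losses does not
    change the difference of their losses. Outside [J] the shifted loss is zero, and only [J] pays a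
    variance. *)
Lemma mirror_step_bound (r : sphere_point R V) (l : V -> R) (a : V)
    (c : R) (J : pred V) :
  (forall i, 0 <= l i) -> 0 <= c -> (forall i, eta i * r i * c <= 1 / 2) ->
  (forall i, ~~ J i -> l i = c) ->
  \sum_i l i * r i ^+ 2 - l a + divergence a (mirror_step r l)
    <= divergence a r
       + \sum_(i | J i) eta i * r i ^+ 3 * (l i ^+ 2 + 2 * c ^+ 2).
Proof.
move=> l0 c0 erc lJ; have [lam stepE] := mirror_stepE r l.
set r' := mirror_step r l in stepE *.
(* With [l i - lam] rewritten by the optimality condition, the three-point identity of Bregman
   divergences holds in each coordinate. *)
have three_points : \sum_i (l i - lam) * (r' i ^+ 2 - (i == a)%:R)
   = divergence a r - divergence a r'
     - \sum_i (eta i)^-1 * ((r' i - r i) ^+ 2 / r i).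
  rewrite /divergence -!sumrB; apply: eq_bigr => i _.
  have ri := coord_gt0 r i; have ri' := coord_gt0 r' i.
  have -> : l i - lam = (eta i)^-1 * ((r' i)^-1 - (r i)^-1).
    by rewrite stepE; field; rewrite !gt_eqF.
  by case: (i == a) => /=; rewrite ?mulr1n ?mulr0n; field; rewrite !gt_eqF.
have sum_delta (g : V -> R) : \sum_i g i * (i == a)%:R = g a.
  rewrite (bigD1 a)//= eqxx mulr1 big1 ?addr0// => i /negPf ->.
  by rewrite mulr0.
(* Constants cancel between two distributions of mass 1; this eliminates [lam]. *)
have shiftE (k : R) :
    \sum_i (l i - k) * (r' i ^+ 2 - (i == a)%:R)
    = \sum_i l i * r' i ^+ 2 - l a.
  under eq_bigr do rewrite mulrBr.
  rewrite sumrB sum_delta.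
  under eq_bigr do rewrite mulrBl.
  by rewrite sumrB -mulr_sumr coord_sum; ring.
have shift_diff : \sum_i l i * r i ^+ 2 - \sum_i l i * r' i ^+ 2
    = \sum_i (l i - c) * (r i ^+ 2 - r' i ^+ 2).
  have -> : \sum_i (l i - c) * (r i ^+ 2 - r' i ^+ 2) =
    \sum_i (l i * r i ^+ 2 - l i * r' i ^+ 2)
      - (\sum_i c * r i ^+ 2 - \sum_i c * r' i ^+ 2).
    by rewrite -!sumrB; apply: eq_bigr => i _; ring.
  by rewrite -!mulr_sumr !coord_sum subrr subr0 sumrB.
rewrite shiftE in three_points.
have : \sum_i ((l i - c) * (r i ^+ 2 - r' i ^+ 2)
               - (eta i)^-1 * ((r' i - r i) ^+ 2 / r i))
   <= \sum_(i | J i) eta i * r i ^+ 3 * (l i ^+ 2 + 2 * c ^+ 2).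
  rewrite [leRHS]big_mkcond; apply: ler_sum => i _; case: ifPn => Ji.
    by apply: coordinate_bound => //; exact: coord_gt0.
  rewrite lJ// subrr mul0r sub0r oppr_le0 mulr_ge0 ?invr_ge0 ?(ltW (eta_gt0 i))//.
  by rewrite divr_ge0 ?sqr_ge0// ltW// coord_gt0.
by rewrite sumrB -shift_diff; lra.
Qed.

End MirrorDescent.

(** * The expected loss, unrolled round by round *)

Lemma sum_cons_tuple (R : nmodType) (V : finType) (n : nat)
    (F : n.+1.-tuple V -> R) :
  \sum_x F x = \sum_(a : V) \sum_(x : n.-tuple V) F [tuple of a :: x].
Proof.
rewrite pair_big (reindex (fun p : V * n.-tuple V => [tuple of p.1 :: p.2]))//=.
exists (fun x => (thead x, [tuple of behead x])) => [[a x] _|x _] /=.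
  by congr pair; apply/val_inj.
by rewrite -tuple_eta.
Qed.

Section SequentialPlay.
Variables (R : realType) (V : finType) (E : rel V) (alg : algorithm R V).

Fixpoint expected_cost (h : seq (observation R V)) (ls : seq (V -> R)) : R :=
  if ls is l :: ls' then
    \sum_a alg h a * (l a + expected_cost (rcons h (observe E l a)) ls')
  else 0.

(** A potential argument: [Phi] telescopes along the play, and its final value is dropped by
    nonnegativity. *)
Lemma expected_cost_le (Phi : seq (observation R V) -> R) (a : V) (B : R) :
  (forall h, 0 <= Phi h) ->
  (forall h l, (forall v, 0 <= l v <= 1) ->
    \sum_v alg h v * (l v + Phi (rcons h (observe E l v))) <= l a + Phi h + B) ->
  forall ls h, (forall l, List.In l ls -> forall v, 0 <= l v <= 1) ->
  expected_cost h ls <= \sum_(l <- ls) l a + Phi h + (size ls)%:R * B.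
Proof.
move=> Phi0 step; elim=> [|l ls IH] h ls01 /=.
  by rewrite big_nil add0r mul0r addr0.
pose S := \sum_(l <- ls) l a + (size ls)%:R * B.
have := step h l (ls01 l (or_introl erefl)).
have : \sum_v alg h v * (l v + expected_cost (rcons h (observe E l v)) ls) <=
    \sum_v (alg h v * (l v + Phi (rcons h (observe E l v))) + alg h v * S).
  apply: ler_sum => v _; rewrite -mulrDr ler_wpM2l ?policy_ge0// -addrA lerD2l.
  have := IH (rcons h (observe E l v)) (fun l' H => ls01 l' (or_intror H)).
  by rewrite /S; lra.
rewrite big_split/= -mulr_suml policy_sum1 mul1r big_cons -natr1 mulrDl mul1r.
by rewrite /S; lra.
Qed.

(** [trajectory_prob] after a past [h]: the prefix lets the induction on the number of rounds go
    through. *)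
Definition continuation_prob (h : seq (observation R V)) (T : nat)
    (loss : 'I_T -> V -> R) (x : T.-tuple V) : R :=
  \prod_(t < T) alg (h ++ history E loss x t) (tnth x t).

Lemma history_cons (T : nat) (loss : 'I_T.+1 -> V -> R) (a : V)
    (x : T.-tuple V) (t : 'I_T) :
  history E loss [tuple of a :: x] (lift ord0 t) =
  observe E (loss ord0) a :: history E (fun s => loss (lift ord0 s)) x t.
Proof.
rewrite /history enum_ordSl /= tnth0; congr cons.
rewrite filter_map -map_comp; apply: eq_map => s /=.
by rewrite tnthS.
Qed.

Lemma continuation_prob_cons (h : seq (observation R V)) (T : nat)
    (loss : 'I_T.+1 -> V -> R) (a : V) (x : T.-tuple V) :
  continuation_prob h loss [tuple of a :: x] =
  alg h a * continuation_prob (rcons h (observe E (loss ord0) a))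
              (fun s => loss (lift ord0 s)) x.
Proof.
rewrite /continuation_prob big_ord_recl tnth0; congr (alg _ a * _).
  rewrite /history (eq_filter (a2 := pred0)) ?filter_pred0 ?cats0//.
apply: eq_bigr => t _; rewrite history_cons tnthS.
by rewrite cat_rcons.
Qed.

Lemma sum_continuation_prob (h : seq (observation R V)) (T : nat)
    (loss : 'I_T -> V -> R) : \sum_x continuation_prob h loss x = 1.
Proof.
elim: T h loss => [|T IH] h loss.
  rewrite (eq_bigr (fun=> 1)) => [|x _]; last by rewrite /continuation_prob big_ord0.
  by rewrite sumr_const card_tuple expn0.
rewrite sum_cons_tuple -(policy_sum1 alg h); apply: eq_bigr => a _.
under eq_bigr do rewrite continuation_prob_cons.
by rewrite -mulr_sumr IH mulr1.
Qed.

Lemma sum_continuation_prob_loss (h : seq (observation R V)) (T : nat)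
    (loss : 'I_T -> V -> R) :
  \sum_x continuation_prob h loss x * \sum_(t < T) loss t (tnth x t) =
  expected_cost h [seq loss t | t <- enum 'I_T].
Proof.
elim: T h loss => [|T IH] h loss.
  rewrite big1 => [|x _]; last by rewrite big_ord0 mulr0.
  by rewrite (size0nil (size_enum_ord 0)).
rewrite sum_cons_tuple enum_ordSl/= -map_comp; apply: eq_bigr => a _.
rewrite -IH; set h' := rcons _ _.
transitivity (\sum_x alg h a * (continuation_prob h' (fun s => loss (lift ord0 s)) x
    * loss ord0 a + continuation_prob h' (fun s => loss (lift ord0 s)) x *
        \sum_(t < T) loss (lift ord0 t) (tnth x t))).
  apply: eq_bigr => x _; rewrite continuation_prob_cons -mulrA -mulrDr.
  rewrite big_ord_recl tnth0; congr (_ * (_ * (_ + _))).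
  by apply: eq_bigr => t _; rewrite tnthS.
rewrite -mulr_sumr big_split/= -mulr_suml sum_continuation_prob mul1r.
by [].
Qed.

Lemma expected_lossE (T : nat) (loss : 'I_T -> V -> R) :
  expected_loss E alg loss = expected_cost [::] [seq loss t | t <- enum 'I_T].
Proof. exact: (sum_continuation_prob_loss [::]). Qed.

Lemma regret_le (Phi : seq (observation R V) -> R) (T : nat)
    (loss : 'I_T -> V -> R) (a : V) (B : R) :
  (forall h, 0 <= Phi h) ->
  (forall h l, (forall v, 0 <= l v <= 1) ->
    \sum_v alg h v * (l v + Phi (rcons h (observe E l v))) <= l a + Phi h + B) ->
  (forall t v, 0 <= loss t v <= 1) ->
  regret_wrt E alg loss a <= Phi [::] + T%:R * B.
Proof.
move=> Phi0 step loss01; rewrite /regret_wrt expected_lossE /arm_loss.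
have ls01 l : List.In l [seq loss t | t <- enum 'I_T] -> forall v, 0 <= l v <= 1.
  by elim: (enum _) => //= t ts IH [<-|/IH].
have := @expected_cost_le Phi a B Phi0 step _ [::] ls01.
rewrite size_map size_enum_ord big_map big_enum/=.
by lra.
Qed.

End SequentialPlay.

(** * Exploration and importance-weighted estimates *)

Section Exploration.
Variables (R : realType) (V : finType) (E : rel V) (f : V -> V) (gamma : R).
Hypothesis E_f : forall v, E (f v) v.
Hypothesis gamma_gt0 : 0 < gamma.
Hypothesis gamma_le : gamma <= 1 / 2.

(* Sample v from the squares of r, then play v, or with probability gamma its
   in-neighbour f v. *)
Definition play (r : V -> R) (v : V) : R :=
  (1 - gamma) * r v ^+ 2 + gamma * \sum_(u | f u == v) r u ^+ 2.

Lemma play_ge (r : V -> R) (v : V) : (1 - gamma) * r v ^+ 2 <= play r v.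
Proof.
rewrite lerDl mulr_ge0 ?(ltW gamma_gt0)// sumr_ge0// => u _; exact: sqr_ge0.
Qed.

Lemma play_ge0 (r : V -> R) (v : V) : 0 <= play r v.
Proof.
apply: le_trans (play_ge r v); rewrite mulr_ge0 ?sqr_ge0// subr_ge0.
by have := gamma_le; lra.
Qed.

Lemma sum_play (r G : V -> R) :
  \sum_a play r a * G a = (1 - gamma) * (\sum_a G a * r a ^+ 2)
                          + gamma * \sum_u r u ^+ 2 * G (f u).
Proof.
under eq_bigr do rewrite mulrDl.
rewrite big_split/= !mulr_sumr; congr (_ + _).
  by apply: eq_bigr => a _; ring.
rewrite [RHS](partition_big f predT)//=; apply: eq_bigr => a _.
rewrite -mulrA mulr_suml mulr_sumr; apply: eq_bigr => u /eqP <-.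
by [].
Qed.

Lemma play_sum1 (r : sphere_point R V) : \sum_a play r a = 1.
Proof.
transitivity (\sum_a play r a * 1); first by apply: eq_bigr => a _; rewrite mulr1.
rewrite sum_play; under eq_bigr do rewrite mul1r.
by under [X in _ + _ * X]eq_bigr do rewrite mulr1; rewrite coord_sum; ring.
Qed.

Definition obs_prob (r : V -> R) (v : V) : R := \sum_(a | E a v) play r a.

Lemma play_le_obs_prob (r : V -> R) (u v : V) : E u v -> play r u <= obs_prob r v.
Proof.
move=> Euv; rewrite /obs_prob (bigD1 u)//= lerDl sumr_ge0// => a _.
exact: play_ge0.
Qed.

Lemma obs_prob_ge (r : V -> R) (v : V) : gamma * r v ^+ 2 <= obs_prob r v.
Proof.
apply: le_trans (play_le_obs_prob r (E_f v)).
apply: (@le_trans _ _ (gamma * \sum_(u | f u == f v) r u ^+ 2)).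
  rewrite ler_wpM2l ?(ltW gamma_gt0)// (bigD1 v)//= lerDl sumr_ge0// => u _.
  exact: sqr_ge0.
rewrite lerDr mulr_ge0 ?sqr_ge0// subr_ge0; have := gamma_le; lra.
Qed.

Lemma obs_prob_gt0 (r : sphere_point R V) (v : V) : 0 < obs_prob r v.
Proof.
apply: lt_le_trans (obs_prob_ge r v).
by rewrite mulr_gt0// exprn_gt0// coord_gt0.
Qed.

Lemma obs_prob_loop (r : V -> R) (v : V) : E v v -> r v ^+ 2 / 2 <= obs_prob r v.
Proof.
move=> Evv; apply: le_trans (play_le_obs_prob r Evv).
apply: le_trans (play_ge r v); have := sqr_ge0 (r v); have := gamma_le; nra.
Qed.

(** All other vertices reveal [v], and each is played with at least half of its mass. *)
Lemma obs_prob_coloop (r : sphere_point R V) (v : V) :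
  Nin E v = ([set: V] :\ v)%SET -> (1 - r v ^+ 2) / 2 <= obs_prob r v.
Proof.
move=> Nv; have Ev a : E a v = (a != v).
  by have /setP/(_ a) := Nv; rewrite !inE andbT.
apply: (@le_trans _ _ (\sum_(a | a != v) r a ^+ 2 / 2)).
  by rewrite -mulr_suml -(coord_sum r) (bigD1 v)//= addrAC subrr add0r.
rewrite /obs_prob (eq_bigl _ _ Ev); apply: ler_sum => a _.
apply: le_trans (play_ge r a); have := sqr_ge0 (r a); have := gamma_le; nra.
Qed.

(** The default 0 for an unobserved loss is what makes the estimate unbiased. *)
Definition estimate (r : V -> R) (o : observation R V) (v : V) : R :=
  odflt 0 (o.2 v) / obs_prob r v.

Lemma estimateE (r l : V -> R) (a v : V) :
  estimate r (observe E l a) v = (if E a v then l v else 0) / obs_prob r v.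
Proof. by rewrite /estimate/= ffunE inE; case: ifP. Qed.

Lemma estimate_mean (r : sphere_point R V) (l : V -> R) (v : V) :
  \sum_a play r a * estimate r (observe E l a) v = l v.
Proof.
transitivity (\sum_(a | E a v) play r a * (l v / obs_prob r v)).
  rewrite [RHS]big_mkcond; apply: eq_bigr => a _; rewrite estimateE.
  by case: ifP; rewrite ?mul0r ?mulr0.
by rewrite -mulr_suml mulrC divfK// gt_eqF// obs_prob_gt0.
Qed.

Section BoundedLoss.
Variables (r : sphere_point R V) (l : V -> R).
Hypothesis l01 : forall v, 0 <= l v <= 1.

Lemma estimate_ge0 (a v : V) : 0 <= estimate r (observe E l a) v.
Proof.
rewrite estimateE divr_ge0//; last exact/ltW/obs_prob_gt0.
by case: ifP => // _; have /andP[] := l01 v.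
Qed.

Lemma estimate_le (a v : V) :
  estimate r (observe E l a) v <= (obs_prob r v)^-1.
Proof.
rewrite estimateE -[leRHS]mul1r ler_wpM2r ?invr_ge0//; first exact/ltW/obs_prob_gt0.
by case: ifP => // _; have /andP[] := l01 v.
Qed.

(** One factor is at most the inverse observation probability; the other has mean [l v <= 1]. *)
Lemma estimate_sq_mean (v : V) :
  \sum_a play r a * estimate r (observe E l a) v ^+ 2 <= (obs_prob r v)^-1.
Proof.
apply: (@le_trans _ _ (\sum_a play r a * estimate r (observe E l a) v
    * (obs_prob r v)^-1)).
  apply: ler_sum => a _; rewrite -mulrA ler_wpM2l ?play_ge0//.
  by rewrite expr2 ler_wpM2l ?estimate_ge0// estimate_le.
rewrite -mulr_suml estimate_mean ler_piMl ?invr_ge0//; first exact/ltW/obs_prob_gt0.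
by have /andP[] := l01 v.
Qed.

End BoundedLoss.

(** * One round, with a shift depending on the observation *)

Section Round.
Variable eta : V -> R.
Hypothesis eta_gt0 : forall i, 0 < eta i.

(** [mirror_step_bound] averaged over the played arm [a], with shift [c a] of second moment at most
    [M]. The summand [gamma] pays for playing in-neighbours. *)
Lemma round_bound (r : sphere_point R V) (l : V -> R) (b : V) (c : V -> R)
    (J : pred V) (M : R) :
  (forall v, 0 <= l v <= 1) ->
  (forall a, 0 <= c a) -> (forall a i, eta i * r i * c a <= 1 / 2) ->
  (forall a i, ~~ J i -> estimate r (observe E l a) i = c a) ->
  \sum_a play r a * c a ^+ 2 <= M ->
  \sum_a play r a * (l a + divergence eta b
      (mirror_step eta_gt0 r (estimate r (observe E l a)))) <=
  l b + divergence eta b r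
  + (gamma + \sum_(i | J i) eta i * r i ^+ 3 * ((obs_prob r i)^-1 + 2 * M)).
Proof.
move=> l01 c0 etac lJ cM.
pose est a := estimate r (observe E l a).
pose D a := divergence eta b (mirror_step eta_gt0 r (est a)).
have loss_played : \sum_a play r a * l a <= gamma + \sum_v l v * r v ^+ 2.
  have lf : \sum_u r u ^+ 2 * l (f u) <= 1.
    rewrite -(coord_sum r); apply: ler_sum => u _.
    by rewrite ler_piMr ?sqr_ge0//; have /andP[] := l01 (f u).
  have l0 : 0 <= \sum_v l v * r v ^+ 2.
    by apply: sumr_ge0 => v _; rewrite mulr_ge0 ?sqr_ge0//; have /andP[] := l01 v.
  rewrite sum_play; have := gamma_gt0; nra.
have step_mean : \sum_v l v * r v ^+ 2 - l b + \sum_a play r a * D a <=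
    divergence eta b r + \sum_(i | J i) eta i * r i ^+ 3 *
      \sum_a play r a * (est a i ^+ 2 + 2 * c a ^+ 2).
  (* Unbiasedness: [r] and [b] do not depend on the arm played. *)
  have -> : \sum_v l v * r v ^+ 2 - l b + \sum_a play r a * D a =
      \sum_a play r a * (\sum_i est a i * r i ^+ 2 - est a b + D a).
    under [RHS]eq_bigr do rewrite mulrDr mulrBr.
    rewrite big_split sumrB/= estimate_mean; congr (_ - _ + _).
    under [RHS]eq_bigr do rewrite mulr_sumr.
    rewrite exchange_big/=; apply: eq_bigr => v _.
    under eq_bigr do rewrite mulrA.
    by rewrite -mulr_suml estimate_mean.
  have -> : divergence eta b r + \sum_(i | J i) eta i * r i ^+ 3 *
      (\sum_a play r a * (est a i ^+ 2 + 2 * c a ^+ 2)) =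
      \sum_a play r a * (divergence eta b r +
        \sum_(i | J i) eta i * r i ^+ 3 * (est a i ^+ 2 + 2 * c a ^+ 2)).
    under [RHS]eq_bigr do rewrite mulrDr.
    rewrite big_split/= -mulr_suml play_sum1 mul1r; congr (_ + _).
    under eq_bigr do rewrite mulr_sumr.
    rewrite exchange_big/=; apply: eq_bigr => a _.
    by rewrite mulr_sumr; apply: eq_bigr => i _; rewrite mulrCA.
  apply: ler_sum => a _; rewrite ler_wpM2l ?play_ge0//.
  apply: mirror_step_bound => // [i|i /lJ]; last exact.
  exact: estimate_ge0.
have second_moment : \sum_(i | J i) eta i * r i ^+ 3 *
      (\sum_a play r a * (est a i ^+ 2 + 2 * c a ^+ 2)) <=
    \sum_(i | J i) eta i * r i ^+ 3 * ((obs_prob r i)^-1 + 2 * M).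
  apply: ler_sum => i _; rewrite ler_wpM2l//.
    by rewrite mulr_ge0 ?exprn_ge0 ?(ltW (coord_gt0 _ _)) ?(ltW (eta_gt0 _)).
  under eq_bigr do rewrite mulrDr [X in _ + X]mulrCA.
  rewrite big_split/= -mulr_sumr lerD ?estimate_sq_mean// ler_wpM2l//.
under eq_bigr do rewrite mulrDr.
by rewrite big_split/= -/(D _); lra.
Qed.

End Round.

End Exploration.

(** * Variance with rate [e] at weak vertices and [e'] elsewhere *)

Section TwoRates.
Variables (R : realType) (V : finType) (E : rel V) (f : V -> V).
Variables (gamma e e' s : R).
Hypothesis E_f : forall v, E (f v) v.
Hypothesis gamma_gt0 : 0 < gamma.
Hypothesis gamma_le : gamma <= 1 / 2.
Hypothesis e_gt0 : 0 < e.
Hypothesis e_le : e <= e'.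
Hypothesis e'_le : 4 * e' <= gamma.
Hypothesis s_gt0 : 0 < s.

Let weak : pred V := fun v => ~~ strongly_observable_vertex E v.
Hypothesis weak_le : #|weak|%:R <= s ^+ 2.

Definition rate (i : V) : R := if strongly_observable_vertex E i then e' else e.

Lemma rate_gt0 i : 0 < rate i.
Proof. by rewrite /rate; case: ifP => _ //; exact: lt_le_trans e_le. Qed.

Lemma rate_le i : rate i <= e'.
Proof. by rewrite /rate; case: ifP. Qed.

(** A weak vertex is seen with probability at least [gamma * r i ^+ 2], a strong one with at least
    [r i ^+ 2 / 4], by its loop or because half of the mass lies elsewhere. The hypothesis excludes
    only heavy loopless vertices, which [round_regret] treats by a shift. *)
Lemma own_variance (r : sphere_point R V) i :
  (strongly_observable_vertex E i -> E i i \/ r i ^+ 2 <= 1 / 2) ->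
  rate i * r i ^+ 3 / obs_prob E f gamma r i <=
    (if weak i then e / gamma * r i else 0) + 4 * e'.
Proof.
move=> hi; have ri := coord_gt0 r i; have ri1 := sphere_le1 r i.
have e'0 : 0 < e' by exact: lt_le_trans e_le.
have P0 := obs_prob_gt0 E_f gamma_gt0 gamma_le r i.
have r2 : 0 < r i ^+ 2 by rewrite exprn_gt0.
rewrite ler_pdivrMr//; have := rate_le i; have := rate_gt0 i; rewrite /rate /weak.
have [so|wk] /= := boolP (strongly_observable_vertex E i) => _ _; last first.
  have := obs_prob_ge E_f gamma_gt0 gamma_le r i => Pge.
  have er : 0 <= e / gamma * r i by rewrite mulr_ge0 ?divr_ge0 ?ltW.
  apply: (@le_trans _ _ (e / gamma * r i * obs_prob E f gamma r i)).
    apply: le_trans (ler_wpM2l er Pge).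
    suff -> : e / gamma * r i * (gamma * r i ^+ 2) = e * r i ^+ 3 by [].
    by field; rewrite gt_eqF.
  by rewrite ler_wpM2r ?(ltW P0)// lerDl; lra.
rewrite add0r [leRHS]mulrAC [leRHS]mulrC ler_pM2l//.
suff : r i ^+ 2 <= 4 * obs_prob E f gamma r i.
  by rewrite exprS; nra.
have [Eii|Eii] := boolP (E i i).
  by have := obs_prob_loop f gamma_gt0 gamma_le r Eii; lra.
have r2half : r i ^+ 2 <= 1 / 2 by case: (hi so) => // Eii'; rewrite Eii' in Eii.
move: so; rewrite /strongly_observable_vertex (negPf Eii)/= => /eqP Ni.
by have := obs_prob_coloop f gamma_gt0 gamma_le r Ni; lra.
Qed.

Definition round_cost : R := gamma + (e * s / gamma + #|V|%:R * (8 * e')).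

Lemma variance_le (r : sphere_point R V) (J : pred V) (M : R) :
  (forall i, J i -> strongly_observable_vertex E i -> E i i \/ r i ^+ 2 <= 1 / 2) ->
  (forall i, J i -> r i ^+ 2 * M <= 2) -> 0 <= M ->
  \sum_(i | J i) rate i * r i ^+ 3 * ((obs_prob E f gamma r i)^-1 + 2 * M)
    <= e * s / gamma + #|V|%:R * (8 * e').
Proof.
move=> Jown JM M0; have e'0 : 0 < e' by exact: lt_le_trans e_le.
have eg : 0 <= e / gamma by rewrite divr_ge0 ?ltW.
apply: (@le_trans _ _ (\sum_(i | J i)
    ((if weak i then e / gamma * r i else 0) + 8 * e'))).
  apply: ler_sum => i Ji; have := own_variance (Jown i Ji).
  (* The shift costs as much as a strong vertex's own variance, whence [8 * e']. *)
  suff : rate i * r i ^+ 3 * (2 * M) <= 4 * e' by rewrite mulrDr; lra.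
  have -> : rate i * r i ^+ 3 * (2 * M) =
      rate i * (2 * r i * (r i ^+ 2 * M)) by ring.
  rewrite [leRHS]mulrC; apply: ler_pM (rate_le i) _; first exact/ltW/rate_gt0.
    by rewrite !mulr_ge0 ?sqr_ge0// ltW// coord_gt0.
  have := JM i Ji; have := sphere_le1 r i; have := coord_gt0 r i.
  have := mulr_ge0 (sqr_ge0 (r i)) M0; nra.
apply: (@le_trans _ _ (\sum_i ((if weak i then e / gamma * r i else 0) + 8 * e'))).
  rewrite [leRHS](bigID J)/= lerDl sumr_ge0// => i _; rewrite addr_ge0//; last lra.
  by case: ifP => // _; rewrite mulr_ge0// ltW// coord_gt0.
rewrite big_split/= -big_mkcond/= -mulr_sumr sumr_const lerD//.
  by rewrite [leRHS]mulrAC ler_wpM2l//; exact: sphere_sum_le.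
by rewrite -[leLHS]mulr_natl.
Qed.

(* A vertex that every other vertex observes but that does not observe itself
   is seen too rarely when it carries most of the mass. Its own estimate is then
   subtracted from all of them: mirror steps are invariant under this shift, and
   what remains of the variance is weighted by the mass of the other vertices. *)
Lemma round_regret (r : sphere_point R V) (l : V -> R) (b : V) :
  (forall v, 0 <= l v <= 1) ->
  \sum_a play f gamma r a * (l a + divergence rate b
      (mirror_step rate_gt0 r (estimate E f gamma r (observe E l a)))) <=
  l b + divergence rate b r + round_cost.
Proof.
move=> l01; have e'0 : 0 < e' by exact: lt_le_trans e_le.
pose heavy v := [&& ~~ E v v, strongly_observable_vertex E v & 1 / 2 < r v ^+ 2].
have [/existsP[v /and3P[nEvv so rv]]|/existsPn light] := boolP [exists v, heavy v].
  have P0 := obs_prob_gt0 E_f gamma_gt0 gamma_le r v.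
  have Nv : Nin E v = ([set: V] :\ v)%SET.
    by move: so; rewrite /strongly_observable_vertex (negPf nEvv) => /eqP.
  have Pge := obs_prob_coloop f gamma_gt0 gamma_le r Nv.
  apply: (le_trans (@round_bound _ _ E f gamma E_f gamma_gt0 gamma_le rate rate_gt0
    r l b (fun a => estimate E f gamma r (observe E l a) v) (predC1 v)
    (obs_prob E f gamma r v)^-1 l01 _ _ _ _)).
  - by move=> a; exact: estimate_ge0.
  - move=> a i.
    (* As [v] is heavy, exploration alone reveals it with probability at least [gamma / 2]. The
       condition on the shift then becomes [4 * e' <= gamma]. *)
    have Pinv : (obs_prob E f gamma r v)^-1 <= 2 / gamma.
      rewrite -[leRHS]invf_div lef_pV2 ?posrE ?divr_gt0//.
      by have := obs_prob_ge E_f gamma_gt0 gamma_le r v; have := gamma_gt0; nra.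
    have est_le := le_trans (estimate_le E_f gamma_gt0 gamma_le r l01 a v) Pinv.
    apply: (@le_trans _ _ (e' * 1 * (2 / gamma))); last first.
      by rewrite mulr1 mulrA ler_pdivrMr//; have := e'_le; lra.
    apply: ler_pM => //; last first.
    + apply: ler_pM (rate_le i) (sphere_le1 r i); first exact/ltW/rate_gt0.
      exact/ltW/coord_gt0.
    + by apply: estimate_ge0.
    + by rewrite mulr_ge0 ?(ltW (rate_gt0 i)) ?(ltW (coord_gt0 _ _)).
  - by move=> a i; rewrite negbK => /eqP ->.
  - exact: estimate_sq_mean.
  rewrite lerD2l lerD2l; apply: variance_le => [i iv _|i iv|].
  - by right; have := sphere_sq_le r iv; lra.
  (* The mass of [i] is part of the mass outside [v], at least half of which reveals [v]. *)
  - by rewrite ler_pdivrMr//; have := sphere_sq_le r iv; lra.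
  - by rewrite invr_ge0 ltW.
(* Without a heavy loopless vertex no shift is made. *)
apply: (le_trans (@round_bound _ _ E f gamma E_f gamma_gt0 gamma_le rate rate_gt0
    r l b (fun=> 0) predT 0 l01 _ _ _ _)) => //.
- by move=> a i; rewrite mulr0; lra.
- by rewrite big1// => a _; rewrite expr0n mulr0.
rewrite lerD2l lerD2l; apply: variance_le => [i _ so|i _|//]; last by rewrite mulr0.
have := light i; rewrite /heavy so/= negb_and negbK -leNgt => /orP[]; first by left.
by right.
Qed.

(** * The starting point and the algorithm *)

Section Start.
Hypothesis weak_gt0 : (0 < #|weak|)%N.

(** Half uniform on all vertices, half uniform on the weak ones. A fully uniform start would bring
    the square root of [#|V|] into the divergence to a weak arm, divided by the small rate [e]. *)
Definition start_coord (i : V) : R :=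
  Num.sqrt ((2 * #|V|%:R)^-1 + (weak i)%:R / (2 * #|weak|%:R)).

Lemma card_gt0R : 0 < #|V|%:R :> R.
Proof. by rewrite ltr0n; apply: leq_trans weak_gt0 (max_card _). Qed.

Lemma start_coord_sq i :
  start_coord i ^+ 2 = (2 * #|V|%:R)^-1 + (weak i)%:R / (2 * #|weak|%:R).
Proof.
by rewrite sqr_sqrtr// addr_ge0 ?divr_ge0 ?invr_ge0 ?mulr_ge0// ler0n.
Qed.

Lemma start_coord_gt0 i : 0 < start_coord i.
Proof.
rewrite sqrtr_gt0 ltr_pwDl ?divr_ge0 ?invr_gt0 ?mulr_gt0 ?card_gt0R//.
Qed.

Lemma start_coord_sum : \sum_i start_coord i ^+ 2 = 1.
Proof.
under eq_bigr do rewrite start_coord_sq.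
rewrite big_split/= sumr_const -mulr_suml.
have -> : \sum_i (weak i)%:R = #|weak|%:R :> R.
  rewrite -sum1_card natr_sum [RHS]big_mkcond; apply: eq_bigr => i _.
  by rewrite -[i \in weak]/(weak i); case: (weak i).
have := card_gt0R; have : 0 < #|weak|%:R :> R by rewrite ltr0n.
rewrite -[X in X + _]mulr_natl => w0 n0; field.
by apply/andP; split; apply: lt0r_neq0.
Qed.

Definition start : sphere_point R V := SpherePoint start_coord_gt0 start_coord_sum.

(** Coordinates other than [b] contribute [start i] over their rate, and [b] at most
    [start b + (start b)^-1] over its own. The weak coordinates sum to at most [s]; the others are
    bounded by 1 each. *)
Lemma divergence_start (b : V) :
  divergence rate b start <= 3 * s / e + 3 * #|V|%:R / e'.
Proof.
have e'0 : 0 < e' by exact: lt_le_trans e_le.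
have n0 := card_gt0R; have n1 : 1 <= #|V|%:R :> R by rewrite ler1n -(ltr0n R).
have w0 : 0 < #|weak|%:R :> R by rewrite ltr0n.
apply: (@le_trans _ _ (\sum_i (rate i)^-1 * start i + (rate b)^-1 / start b)).
  rewrite /divergence (bigD1 b)//= [X in _ <= X + _](bigD1 b)//= eqxx addrAC lerD//.
    have rb := start_coord_gt0 b.
    have ib : 0 <= (rate b)^-1 by rewrite invr_ge0 ltW// rate_gt0.
    rewrite -mulrDr ler_wpM2l// ler_pdivrMr// mulrDl mulVf ?gt_eqF//=.
    by rewrite mulr1n; nra.
  apply: ler_sum => i /negPf ->; rewrite sub0r sqrrN expr2 mulfK//.
  by rewrite gt_eqF// start_coord_gt0.
have sum_le : \sum_i (rate i)^-1 * start i <= s / e + #|V|%:R / e'.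
  rewrite (bigID weak)/=; apply: lerD.
    rewrite (eq_bigr (fun i => e^-1 * start i)) => [|i /negPf wi]; last first.
      by rewrite /rate wi.
    by rewrite -mulr_sumr mulrC ler_wpM2r ?invr_ge0 ?(ltW e_gt0)// sphere_sum_le.
  apply: (@le_trans _ _ (\sum_(i : V) e'^-1)).
    rewrite [leRHS](bigID weak)/= -[leLHS]add0r lerD ?sumr_ge0// => [i _|].
      by rewrite invr_ge0 ltW.
    apply: ler_sum => i; rewrite negbK /rate => ->.
    rewrite ler_piMr ?invr_ge0 ?(ltW e'0)//; exact: (sphere_le1 start).
  by rewrite sumr_const mulr_natl.
suff : (rate b)^-1 / start b <= 2 * s / e + 2 * #|V|%:R / e'.
  by rewrite -!mulrA; lra.
have inv_le (y : R) : 0 < y -> (2 * y) ^- 2 <= start b ^+ 2 -> (start b)^-1 <= 2 * y.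
  move=> y0; rewrite -exprVn ler_sqr ?nnegrE ?invr_ge0 ?mulr_ge0 ?(ltW y0)//.
    move=> h; rewrite -[leRHS]invrK lef_pV2// posrE ?invr_gt0 ?mulr_gt0//.
    exact: start_coord_gt0.
  exact/ltW/coord_gt0.
have se0 : 0 <= 2 * s / e by rewrite divr_ge0 ?mulr_ge0 ?ltW.
have ne0 : 0 <= 2 * #|V|%:R / e' by rewrite divr_ge0 ?mulr_ge0 ?ltW.
rewrite /rate; case: ifPn => sb; rewrite mulrC.
  apply: (@le_trans _ _ (2 * #|V|%:R / e')); last by lra.
  rewrite ler_wpM2r ?invr_ge0 ?(ltW e'0)// inv_le// start_coord_sq.
  rewrite -[leLHS]addr0 lerD ?divr_ge0 ?mulr_ge0 ?ler0n//.
  by rewrite lef_pV2 ?posrE ?exprn_gt0 ?mulr_gt0//; nra.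
apply: (@le_trans _ _ (2 * s / e)); last by lra.
rewrite ler_wpM2r ?invr_ge0 ?(ltW e_gt0)// inv_le// start_coord_sq /weak sb mul1r.
rewrite -[leLHS]add0r lerD ?invr_ge0 ?mulr_ge0 ?ler0n//.
rewrite lef_pV2 ?posrE ?exprn_gt0 ?mulr_gt0//; have := weak_le; nra.
Qed.

Definition state (h : seq (observation R V)) : sphere_point R V :=
  foldl (fun r o => mirror_step rate_gt0 r (estimate E f gamma r o)) start h.

Definition exploring_mirror_descent : algorithm R V :=
  @Algorithm R V (fun h => play f gamma (state h))
    (fun h => play_ge0 f gamma_gt0 gamma_le (state h))
    (fun h => play_sum1 f gamma (state h)).

Lemma divergence_ge0 (b : V) (r : sphere_point R V) : 0 <= divergence rate b r.
Proof.
apply: sumr_ge0 => i _.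
rewrite mulr_ge0 ?divr_ge0 ?sqr_ge0 ?invr_ge0 ?(ltW (coord_gt0 _ _))//.
exact/ltW/rate_gt0.
Qed.

Lemma exploring_mirror_descent_regret (T : nat) (loss : 'I_T -> V -> R) (b : V) :
  (forall t v, 0 <= loss t v <= 1) ->
  regret_wrt E exploring_mirror_descent loss b <=
    3 * s / e + 3 * #|V|%:R / e' + T%:R * round_cost.
Proof.
move=> loss01; have := divergence_start b.
suff : regret_wrt E exploring_mirror_descent loss b <=
    divergence rate b start + T%:R * round_cost by lra.
(* The potential is the divergence from the current state to the comparator [b]. *)
apply: (@regret_le _ _ E exploring_mirror_descent
  (fun h => divergence rate b (state h))) => // [h|h l l01].
  exact: divergence_ge0.
under eq_bigr do rewrite /state foldl_rcons.
exact: (round_regret (state h) b l01).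
Qed.

End Start.
End TwoRates.

(** * Tuning of the parameters *)

Theorem theorem2 (R : realType) (V : finType) (E : rel V) (C : nat)
  (hE : weakly_observable E)
  (hC : (#|[set v : V | ~~ strongly_observable_vertex E v]%SET| <= C)%N) :
  exists T0 : nat, forall T : nat, (T0 <= T)%N ->
    exists alg : algorithm R V,
      forall loss : 'I_T -> V -> R,
        (forall t v, 0 <= loss t v <= 1) ->
        regret E alg loss
          <= 9 * (4 * C%:R) `^ (1 / 3) * T%:R `^ (2 / 3).
Proof.
have /andP[/existsPn obs /forallPn[w0 weak_w0]] := hE.
have in_nbr v : exists u, E u v.
  by have /set0Pn[u] := obs v; rewrite inE; exists u.
pose f v := xchoose (in_nbr v).
have E_f v : E (f v) v by exact: (xchooseP (in_nbr v)).
pose weak v := ~~ strongly_observable_vertex E v.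
have weakE : #|[set v | weak v]%SET| = #|weak| by apply: eq_card => v; rewrite inE.
rewrite weakE in hC.
have weak_gt0 : (0 < #|weak|)%N by apply/card_gt0P; exists w0.
have C_gt0 : (0 < C)%N by exact: leq_trans hC.
have V_gt0 : (0 < #|V|)%N by apply/card_gt0P; exists w0.
(* [H] is the numerator of [e']; the cube in [T0] is what [Q2] needs after raising to the sixth
   power of [Q]. *)
pose H := (3 * #|V| * C)%N; pose T0 := ((8 * #|V| * H) ^ 3)%N.
exists T0 => T T0T.
pose n : R := #|V|%:R; pose c : R := C%:R; pose t : R := T%:R.
pose h : R := 3 * n * c.
have n1 : 1 <= n by rewrite ler1n.
have c1 : 1 <= c by rewrite ler1n.
have tT0 : (8 * n * h) ^+ 3 <= t.
  by rewrite /t /n /h /c -!natrM -natrX ler_nat.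
have h3c : 3 * c <= h by rewrite /h; nra.
have nh : h <= n * h by nra.
have ht : 8 * n * h <= t.
  have : 1 <= 8 * n * h by lra.
  by move=> ?; apply: le_trans tT0; rewrite ler_eXnr.
have c8t : 8 * c <= t by lra.
have t0 : 0 < t by lra.
pose Q := c `^ (1 / 3) * t `^ (2 / 3).
have Q0 : 0 < Q by rewrite mulr_gt0 ?powR_gt0//; lra.
(* From here on [Q] enters through its cube, free of real exponents. *)
have Q3 : Q ^+ 3 = c * t ^+ 2.
  rewrite exprMn -!powR_mulrn ?powR_ge0// -!powRrM.
  have -> : 1 / 3 * 3 = 1 :> R by field.
  have -> : 2 / 3 * 3 = 2 :> R by field.
  by rewrite powRr1//; lra.
have Qt : Q <= t / 2.
  have : Q ^+ 3 <= (t / 2) ^+ 3.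
    by rewrite Q3 -subr_ge0; nra.
  by rewrite ler_pXn2r// nnegrE ?divr_ge0 ?ltW.
(* This gives both [4 * e' <= gamma] and the bound [Q] on the strong variance over all rounds. *)
have Q2 : 8 * n * h * t <= Q ^+ 2.
  have : (8 * n * h * t) ^+ 3 <= (Q ^+ 2) ^+ 3.
    rewrite exprAC Q3 exprMn.
    have -> : (c * t ^+ 2) ^+ 2 = c ^+ 2 * t * t ^+ 3 by ring.
    rewrite ler_wpM2r ?exprn_ge0 ?(ltW t0)//.
    apply: le_trans tT0 _; rewrite ler_peMl ?(ltW t0)//; nra.
  by rewrite ler_pXn2r// nnegrE ?sqr_ge0// !mulr_ge0 ?ltW//; lra.
pose s := Num.sqrt c.
have s2 : s ^+ 2 = c by rewrite sqr_sqrtr//; lra.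
have s0 : 0 < s by rewrite sqrtr_gt0; lra.
have sh : s <= h by nra.
have h0 : 0 < h by lra.
have weak_le : #|weak|%:R <= s ^+ 2 by rewrite s2 ler_nat.
have gamma_gt0 : 0 < Q / t by rewrite divr_gt0.
have gamma_le : Q / t <= 1 / 2 by rewrite ler_pdivrMr//; lra.
have e_gt0 : 0 < s / Q by rewrite divr_gt0.
have e_le : s / Q <= h / Q by rewrite ler_wpM2r// invr_ge0 ltW.
have e'_le : 4 * (h / Q) <= Q / t.
  rewrite mulrA ler_pdivrMr// mulrAC ler_pdivlMr// -expr2.
  apply: le_trans Q2; nra.
pose alg := exploring_mirror_descent f gamma_gt0 gamma_le e_gt0 e_le weak_gt0.
exists alg.
move=> loss loss01; rewrite /regret; apply: ge_sup.
  by exists (regret_wrt E alg loss w0), w0.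
move=> _ [b _ <-].
apply: le_trans (exploring_mirror_descent_regret E_f gamma_gt0 gamma_le e_gt0
  e_le e'_le s0 weak_le weak_gt0 b loss01) _.
have -> : 9 * (4 * C%:R) `^ (1 / 3) * T%:R `^ (2 / 3) = 9 * 4 `^ (1 / 3) * Q.
  by rewrite powRM// /Q; ring.
have four1 : 1 <= 4 `^ (1 / 3) :> R.
  by rewrite -[leLHS](powRr0 (4 : R)) ler_powR//; lra.
(* The start costs [3 * Q] for weak and [Q] for strong vertices; exploration and the two variances
   cost at most [Q] each. *)
apply: (@le_trans _ _ (7 * Q)); last first.
  by rewrite ler_wpM2r ?(ltW Q0)//; lra.
rewrite /round_cost -/n -/t.
have -> : 3 * s / (s / Q) = 3 * Q by field; rewrite !gt_eqF.
have n_le : 3 * n / (h / Q) <= Q.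
  have -> : 3 * n / (h / Q) = Q / c by rewrite /h; field; rewrite !gt_eqF//; lra.
  by rewrite ler_pdivrMr; nra.
have cost1 : t * (Q / t) = Q by field; rewrite gt_eqF.
have cost2 : t * (s / Q * s / (Q / t)) = Q.
  have -> : t * (s / Q * s / (Q / t)) = s ^+ 2 * t ^+ 2 / Q ^+ 2.
    by field; rewrite !gt_eqF.
  by rewrite s2 -Q3; field; rewrite gt_eqF.
have cost3 : t * (n * (8 * (h / Q))) <= Q.
  have -> : t * (n * (8 * (h / Q))) = 8 * n * h * t / Q by ring.
  by rewrite ler_pdivrMr// -expr2.
by rewrite !mulrDr cost1 cost2; lra.
Qed.
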